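(* Let $n\ge 1$ and let $A=[a_{i,j}]\in\mathcal{H}_n$ have nonnegative entries ($a_{i,j}\ge 0$ for all $i,j$). Then $$\lambda_{\max}(F_A)\le\operatorname{per}(A).$$
   Context: $\mathcal{H}_n$ denotes the set of $n\times n$ positive semidefinite Hermitian (complex) matrices. The permanent of an $n\times n$ matrix $A=[a_{i,j}]$ is $\operatorname{per}(A)=\sum_{\sigma\in S_n}\prod_{i=1}^n a_{i,\sigma(i)}$ (it is a nonnegative real number when $A\in\mathcal{H}_n$). For $A=[a_{i,j}]\in\mathcal{H}_n$, $F_A=[f_{i,j}]$ is the $n\times n$ matrix with $f_{i,j}=a_{i,j}\operatorname{per}(A(i,j))$, where $A(i,j)$ is the $(n-1)\times(n-1)$ submatrix of $A$ obtained by deleting the $i$-th row and $j$-th column (the permanent of an empty matrix is $1$); $F_A$ is again a positive semidefinite Hermitian matrix, and $\lambda_{\max}(F_A)$ denotes its largest eigenvalue. *)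

(* Defs.v *)
From mathcomp Require Import all_boot all_order all_fingroup all_algebra.
From mathcomp Require Import complex.
From mathcomp Require Import boolp classical_sets reals.

Set Implicit Arguments.
Unset Strict Implicit.
Unset Printing Implicit Defensive.

Import Order.TTheory GRing.Theory Num.Theory.

Local Open Scope ring_scope.
Local Open Scope complex_scope.
Local Open Scope sesquilinear_scope.

(* The order on R[i] is the partial one of numClosedFieldType: 0 <= z says that
   z is a nonnegative real. *)
Definition psd_hermitian (R : realType) (n : nat) (A : 'M[R[i]]_n) : Prop :=
  A \is hermsymmx /\ forall x : 'cV[R[i]]_n, 0 <= (x ^t* *m A *m x) ord0 ord0.

Definition per (C : comNzRingType) (n : nat) (A : 'M[C]_n) : C :=
  \sum_(s : 'S_n) \prod_(i < n) A i (s i).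

Definition Fmx (C : comNzRingType) (n : nat) (A : 'M[C]_n) : 'M[C]_n :=
  \matrix_(i, j) (A i j * per (row' i (col' j A))).

(* By lambda_max_spec below, for a Hermitian matrix of
   positive size all eigenvalues are real and this is the largest of them. *)
Definition lambda_max (R : realType) (n : nat) (M : 'M[R[i]]_n) : R :=
  sup [set l : R | eigenvalue M l%:C]%classic.

Lemma hermitian_eigenvalue_real (R : realType) (n : nat) (M : 'M[R[i]]_n)
    (a : R[i]) :
  M \is hermsymmx -> eigenvalue M a -> a = (complex.Re a)%:C.
Proof.
move=> /is_hermitianmxP; rewrite expr0 scale1r => Mh /eigenvalueP[v vM v0].
have q0 : v *m v ^t* != 0.
  have : 0 < dotmx v v by apply: neq0_dnorm_gt0.
  by rewrite dotmxE; apply: contraTneq => ->; rewrite mxE ltxx.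
have e1 : v *m M *m v ^t* = a *: (v *m v ^t*) by rewrite vM scalemxAl.
have e2 : v *m M *m v ^t* = Num.conj a *: (v *m v ^t*).
  rewrite {1}Mh -mulmxA -map_mxM -trmx_mul vM linearZ/= map_mxZ.
  by rewrite -scalemxAr.
have : Num.conj a = a.
  apply/eqP; rewrite -subr_eq0; apply: contraNT q0 => d0.
  by rewrite -(inj_eq (scalerI d0)) scaler0 scalerBl -e1 -e2 subrr.
by move=> /CrealP /RRe_real.
Qed.

Lemma seq_max (R : realType) (s : seq R) (x0 : R) :
  x0 \in s -> exists2 m, m \in s & {in s, forall x, x <= m}.
Proof.
elim: s x0 => [//|y [|z s] IHs] x0 _.
  by exists y; rewrite ?mem_head// => x; rewrite inE => /eqP->.
have [m ms mP] := IHs z (mem_head _ _).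
have [ym|/ltW my] := leP y m.
  exists m; first by rewrite inE ms orbT.
  by move=> x; rewrite inE => /predU1P[->//|/mP].
exists y; first exact: mem_head.
by move=> x; rewrite inE => /predU1P[->//|/mP xm]; apply: le_trans my.
Qed.


Lemma lambda_max_spec (R : realType) (n : nat) (M : 'M[R[i]]_n) :
  (0 < n)%N -> M \is hermsymmx ->
  eigenvalue M (lambda_max M)%:C /\
  forall a, eigenvalue M a -> a <= (lambda_max M)%:C.
Proof.
move=> n0 Mh.
have [r rE] := closed_field_poly_normal (char_poly M).
have rP a : eigenvalue M a = (a \in r).
  rewrite eigenvalue_root_char rE (monicP (char_poly_monic M)) scale1r.
  exact: root_prod_XsubC.
pose s := [seq complex.Re z | z <- r].
have sP (x : R) : eigenvalue M x%:C <-> x \in s.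
  rewrite rP; split => [xr|/mapP[z zr ->]]; first by apply/mapP; exists x%:C.
  by rewrite -(hermitian_eigenvalue_real Mh) ?rP.
have [a aM] := eigenvalue_closed M n0.
have [m ms mP] : exists2 m, m \in s & {in s, forall x, x <= m}.
  apply: (@seq_max _ _ (complex.Re a)).
  by apply/sP; rewrite -(hermitian_eigenvalue_real Mh).
have -> : lambda_max M = m.
  apply/eqP; rewrite eq_le; apply/andP; split.
    by apply: ge_sup; [exists m; apply/sP | move=> x /sP /mP].
  by apply: ub_le_sup; [exists m => x /sP /mP | apply/sP].
split=> [|b bM]; first exact/sP.
rewrite (hermitian_eigenvalue_real Mh bM) lecR; apply/mP/sP.
by rewrite -(hermitian_eigenvalue_real Mh).
Qed.

Lemma per_tr (C : comNzRingType) (n : nat) (A : 'M[C]_n) : per A^T = per A.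
Proof.
rewrite /per (reindex_inj invg_inj)/=; apply: eq_bigr => s _.
rewrite (reindex_inj (@perm_inj _ s))/=; apply: eq_bigr => i _.
by rewrite mxE permK.
Qed.

Lemma Fmx_hermitian (R : realType) (n : nat) (A : 'M[R[i]]_n) :
  A \is hermsymmx -> Fmx A \is hermsymmx.
Proof.
move=> /is_hermitianmxP; rewrite expr0 scale1r => Ah.
have Aij i j : A i j = Num.conj (A j i) by rewrite {1}Ah !mxE.
apply/is_hermitianmxP; rewrite expr0 scale1r.
apply/matrixP => i j; rewrite !mxE rmorphM/= -Aij; congr (_ * _).
rewrite -per_tr /per rmorph_sum/=; apply: eq_bigr => s _.
by rewrite rmorph_prod; apply: eq_bigr => k _; rewrite !mxE Aij.
Qed.

(* Main.v *)
Require Import Defs.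
From mathcomp Require Import all_boot all_order all_fingroup all_algebra.
From mathcomp Require Import complex.
From mathcomp Require Import reals.

Import Order.TTheory GRing.Theory Num.Theory.

Local Open Scope ring_scope.
Local Open Scope complex_scope.

(** For a nonnegative [A] the matrix [Fmx A] is nonnegative too, and by Laplace
    expansion ([expand_per_row]) each of its rows sums to [per A].  Right
    multiplication by a matrix whose absolute row sums are at most [c] increases
    the l1 norm of a row vector by a factor at most [c], so that the eigenvalues
    of this matrix have modulus at most [c] ([eigenvalue_norm_le_row_sum]).
    Hermitian symmetry passes from [A] to [Fmx A] and makes
    [lambda_max (Fmx A)], which is defined as a supremum, a genuine eigenvalue,
    to which this bound applies. *)

Lemma lift_perm_inj (n : nat) (i j : 'I_n.+1) : injective (lift_perm i j).
Proof.
move=> s t st; apply/permP => k; apply: (@lift_inj _ j).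
by rewrite -!(lift_perm_lift i) st.
Qed.

Lemma lift_perm_onto (n : nat) (i j : 'I_n.+1) (s : 'S_n.+1) :
  s i = j -> exists t : 'S_n, s = lift_perm i j t.
Proof.
move=> sij.
(* Off [i], [s] avoids [j], so that the default value [k] is never used. *)
pose f k := odflt k (unlift j (s (lift i k))).
have fK k : lift j (f k) = s (lift i k).
  rewrite /f; case: unliftP => [l -> //|].
  by rewrite -sij => /perm_inj/esym/eqP; rewrite (negPf (neq_lift _ _)).
have f_inj : injective f.
  by move=> k l /(congr1 (lift j)); rewrite !fK => /perm_inj/lift_inj.
exists (perm f_inj); apply/permP => k.
by case: (unliftP i k) => [l|] ->;
   rewrite ?lift_perm_id // lift_perm_lift permE fK.
Qed.

(** Laplace expansion along a row, with no signs to follow: the permutations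
    sending [i] to [j] are exactly the [lift_perm i j t], where [t] permutes
    the remaining indices. *)
Lemma expand_per_row (C : comNzRingType) (n : nat) (A : 'M[C]_n) (i : 'I_n) :
  per A = \sum_j A i j * per (row' i (col' j A)).
Proof.
case: n A i => [|n] A i; first by case: i.
rewrite {1}/per (partition_big (fun s : 'S_n.+1 => s i) predT) //=.
apply: eq_bigr => j _; rewrite /per big_distrr /=.
rewrite (eq_bigl [in [set lift_perm i j t | t in 'S_n]]); last first.
  move=> s /=; apply/eqP/imsetP => [/lift_perm_onto[t ->]|[t _ ->]].
    by exists t.
  exact: lift_perm_id.
rewrite big_imset /=; last by move=> s t _ _; apply: lift_perm_inj.
apply: eq_bigr => t _; rewrite (bigD1_ord i) //= lift_perm_id; congr (_ * _).
by apply: eq_bigr => k _; rewrite !mxE lift_perm_lift.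
Qed.

(** Eigenvectors are row vectors here, so that row sums call for the l1 norm:
    sum over [j] the triangle inequality for [a * v_j = \sum_i v_i * M i j], and
    exchange the sums. *)
Lemma eigenvalue_norm_le_row_sum (C : numFieldType) (n : nat) (M : 'M[C]_n)
    (a c : C) :
  eigenvalue M a -> (forall i, \sum_j `|M i j| <= c) -> `|a| <= c.
Proof.
move=> /eigenvalueP[v vM v0] Mc.
have v_gt0 : 0 < \sum_j `|v ord0 j|.
  rewrite lt_def sumr_ge0 // andbT; apply: contra v0 => /eqP.
  move=> /psumr_eq0P v00; apply/eqP/rowP => j; rewrite mxE.
  by apply/normr0_eq0/v00.
rewrite -(ler_pM2r v_gt0) mulr_sumr.
have -> : \sum_j `|a| * `|v ord0 j| = \sum_j `|\sum_i v ord0 i * M i j|.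
  apply: eq_bigr => j _; rewrite -normrM.
  by move/rowP/(_ j): vM; rewrite !mxE => ->.
apply: (@le_trans _ _ (\sum_j \sum_i `|v ord0 i| * `|M i j|)).
  apply: ler_sum => j _; apply: le_trans (ler_norm_sum _ _ _) _.
  by under eq_bigr do rewrite normrM.
rewrite exchange_big /= mulr_sumr; apply: ler_sum => i _.
by rewrite -mulr_sumr mulrC ler_wpM2r.
Qed.

Lemma per_ge0 (C : numDomainType) (n : nat) (A : 'M[C]_n) :
  (forall i j, 0 <= A i j) -> 0 <= per A.
Proof. by move=> A0; apply: sumr_ge0 => s _; apply: prodr_ge0. Qed.

Theorem corollary2 (R : realType) (n : nat) (A : 'M[R[i]]_n) :
  (1 <= n)%N ->
  psd_hermitian A ->
  (forall i j : 'I_n, 0 <= A i j) ->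
  (lambda_max (Fmx A))%:C <= per A.
Proof.
move=> n_gt0 [Aherm _] A0.
have [lambdaE _] := lambda_max_spec n_gt0 (Fmx_hermitian Aherm).
have lambda_real : (lambda_max (Fmx A))%:C \is Num.real.
  by apply/complex_realP; exists (lambda_max (Fmx A)).
apply: le_trans (real_ler_norm lambda_real) _.
apply: eigenvalue_norm_le_row_sum lambdaE _ => i.
rewrite (expand_per_row _ _ A i); apply: ler_sum => j _.
rewrite mxE ger0_norm // mulr_ge0 // per_ge0 // => k l.
by rewrite !mxE.
Qed.
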